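(* Let $P\subset\mathbb{R}^m$ be a convex polytope with non-empty interior, $S\subset P$ a finite set with convex hull $P$, and $c:S\to\mathbb{R}_{>0}$. Let $K$ be a relatively open face of $P$ (the case $K=P^o$ is allowed) and let $x\in K$. Let $$I^x(y)=\sup_{\tau\in\mathbb{R}^m}\{\langle y,\tau\rangle-\log\chi_x(\tau)\},\qquad \chi_x(\tau)=\sum_{\alpha\in S}m_{S,c,\alpha}(x)e^{\langle\tau,\alpha\rangle},\qquad y\in\mathbb{R}^m,$$ be the rate function in the large deviations principle for the dilated convolution powers of the finitely supported Bernstein measure $\mathcal{B}_{S,c}$ at $x$. Then $$I^x(y)=\begin{cases}+\infty,& y\notin\overline{K},\\ \delta_K(x)-\delta_K(y)+\langle x-y,\tau_K(x)\rangle,& y\in\overline{K}.\end{cases}$$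
   Context: For each relatively open face $K$ of $P$ (including $K=P^o$) put $S_K=S\cap\overline K$, $X_K=\mathrm{span}_{\mathbb{R}}\{\alpha-\beta:\alpha,\beta\in S_K\}$, $\chi_{S_K}(\tau)=\sum_{\alpha\in S_K}c(\alpha)e^{\langle\alpha,\tau\rangle}$ and $\mu_K(\tau)=\sum_{\alpha\in S_K}\frac{c(\alpha)e^{\langle\alpha,\tau\rangle}}{\chi_{S_K}(\tau)}\alpha$. The map $\mu_K$ is invariant under translation by the orthogonal complement $X_K^\perp$, and its restriction $\mu_K:X_K\to K$ is a diffeomorphism (well-known); $\tau_K:K\to X_K$ denotes the inverse. The functions $m_{S,c,\alpha}$ ($\alpha\in S$) on $P$ are given, for $x$ in the relatively open face $K$, by $m_{S,c,\alpha}(x)=\frac{c(\alpha)e^{\langle\alpha,\tau_K(x)\rangle}}{\chi_{S_K}(\tau_K(x))}$ if $\alpha\in S_K$ and $m_{S,c,\alpha}(x)=0$ otherwise. The Bernstein measure $\mathcal{B}_{S,c}$ is $\mathcal{B}_{S,c}(x)=\sum_{\alpha\in S}m_{S,c,\alpha}(x)\delta_\alpha$. The function $\delta_K$ is defined on $K$ by $\delta_K(x)=\log\chi_{S_K}(\tau_K(x))-\langle x,\tau_K(x)\rangle$; it extends continuously to $\overline K$, the extension being given on each relatively open face $L$ of $\overline K$ by $\delta_L$, and $\delta_K(y)$ for $y\in\overline K$ refers to this extension. *)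

(* Defs.v *)
From HB Require Import structures.
From mathcomp Require Import all_boot all_order all_algebra.
From mathcomp Require Import finmap.
From mathcomp Require Import all_classical all_reals all_analysis.

Set Implicit Arguments.
Unset Strict Implicit.
Unset Printing Implicit Defensive.

Import Order.TTheory GRing.Theory Num.Theory.
Import numFieldNormedType.Exports.

Local Open Scope classical_set_scope.
Local Open Scope ring_scope.

Section ConvexGeometry.
Context {R : realType} {m : nat}.
Local Notation V := 'rV[R]_m.
Implicit Types (A F K P : set V) (S : {fset V}) (x y u : V).

Definition dotp x y : R := \sum_(i < m) x 0 i * y 0 i.

Definition conv_hull S : set V :=
  [set x | exists w : V -> R,
    [/\ forall a, a \in S -> 0 <= w a,
        \sum_(a <- S) w a = 1
      & x = \sum_(a <- S) w a *: a]].

Definition polytope P : Prop := exists S, P = conv_hull S.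

Definition aff_hull A : set V :=
  [set x | exists (n : nat) (p : 'I_n -> V) (w : 'I_n -> R),
    [/\ forall i, A (p i),
        \sum_(i < n) w i = 1
      & x = \sum_(i < n) w i *: p i]].

Definition relint A : set V :=
  [set x | A x /\ \forall z \near within (aff_hull A) (nbhs x), A z].

(* Nonempty closed faces, cut out by supporting hyperplanes; u = 0 and h = 0
   give P itself. *)
Definition closed_face P F : Prop :=
  F !=set0 /\
  exists (u : V) (h : R),
    (forall z, P z -> dotp u z <= h) /\
    F = [set z | P z /\ dotp u z = h].

Definition relopen_face P K : Prop :=
  exists F, closed_face P F /\ K = relint F.

(* The relatively open faces of a polytope P partition P; this is the one
   containing x (and set0 if there is none). *)
Definition face_at P x : set V := xget set0 [set K | relopen_face P K /\ K x].

End ConvexGeometry.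

Section Bernstein.
Context {R : realType} {m : nat}.
Local Notation V := 'rV[R]_m.
Variables (S : {fset V}) (c : V -> R).
Implicit Types (K P : set V) (x y t a : V).

Definition pts K : {fset V} := [fset a in S | a \in closure K]%fset.

Definition dirspace K : {vspace V} :=
  <<[seq a - b | a <- enum_fset (pts K), b <- enum_fset (pts K)]>>%VS.

Definition chi K t : R := \sum_(a <- pts K) c a * expR (dotp a t).

Definition mu K t : V :=
  \sum_(a <- pts K) (c a * expR (dotp a t) / chi K t) *: a.

(* Inverse of the restriction of mu K to the subspace X_K = dirspace K, which
   is a bijection onto K when K is a relatively open face. *)
Definition tau K : V -> V := 'pinv_(fun=> 0) [set t | t \in dirspace K] (mu K).

Definition bernstein_weight P a x : R :=
  let K := face_at P x in
  if a \in pts K then c a * expR (dotp a (tau K x)) / chi K (tau K x) else 0.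

Definition delta K x : R := ln (chi K (tau K x)) - dotp x (tau K x).

(* Continuous extension of delta K to the closure of K: it is delta L on each
   relatively open face L of closure K. *)
Definition delta_ext K y : R := delta (face_at (closure K) y) y.

Definition chi_at P x t : R :=
  \sum_(a <- S) bernstein_weight P a x * expR (dotp t a).

Definition rate P x y : \bar R :=
  ereal_sup (range (fun t : V => (dotp y t - ln (chi_at P x t))%:E)).

End Bernstein.

(* Main.v *)
(** After the exponential tilt by [tau K x], the rate function becomes, up to an
    explicit affine term, the Legendre transform of [ln chi K] on the points of
    [S] lying on the closed face.

    If [y] is not in that face, a strictly separating direction makes the
    Legendre transform infinite.  If [y] lies on the relatively open subface [L],
    then [y = mu L t] with [t = tau L y].  Dropping the terms outside [L] and
    using the tangent inequality for [exp] bounds the transform by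
    [<y, t> - ln (chi L t)], and this value is approached along [t + r u] as
    [r] tends to infinity, for [u] a normal vector of [L].

    Both the surjectivity of [mu] and the existence of separating or supporting
    functionals come from minimising a coercive sum of exponentials. *)
Require Import Defs.
From mathcomp Require Import all_boot all_order all_algebra.
From mathcomp Require Import finmap.
From mathcomp Require Import all_classical all_reals all_analysis.
From mathcomp Require Import ring lra.
Import Order.TTheory GRing.Theory Num.Theory.
Import numFieldNormedType.Exports.
Local Open Scope classical_set_scope.
Local Open Scope ring_scope.

Set Implicit Arguments.
Unset Strict Implicit.
Unset Printing Implicit Defensive.

(** * Continuity in finite dimension *)

Section DotProduct.
Context {R : realType} {m : nat}.
Local Notation V := 'rV[R]_m.
Implicit Types (x y u t : V) (r : R).

Lemma dotpC x y : dotp x y = dotp y x.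
Proof. by apply: eq_bigr => i _; rewrite mulrC. Qed.

Lemma dotpDl x y u : dotp (x + y) u = dotp x u + dotp y u.
Proof. by rewrite -big_split; apply: eq_bigr => i _; rewrite mxE mulrDl. Qed.

Lemma dotpZl r x u : dotp (r *: x) u = r * dotp x u.
Proof. by rewrite mulr_sumr; apply: eq_bigr => i _; rewrite mxE mulrA. Qed.

Lemma dotp0l u : dotp 0 u = 0.
Proof. by rewrite -(scale0r 0) dotpZl mul0r. Qed.

Lemma dotpBl x y u : dotp (x - y) u = dotp x u - dotp y u.
Proof. by rewrite dotpDl -scaleN1r dotpZl mulN1r. Qed.

Lemma dotpDr x y u : dotp u (x + y) = dotp u x + dotp u y.
Proof. by rewrite dotpC dotpDl !(dotpC u). Qed.

Lemma dotpBr x y u : dotp u (x - y) = dotp u x - dotp u y.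
Proof. by rewrite dotpC dotpBl !(dotpC u). Qed.

Lemma dotpZr r x u : dotp u (r *: x) = r * dotp u x.
Proof. by rewrite dotpC dotpZl dotpC. Qed.

Lemma dotp_suml (I : Type) (s : seq I) (F : I -> V) u :
  dotp (\sum_(i <- s) F i) u = \sum_(i <- s) dotp (F i) u.
Proof.
apply: (big_ind2 (fun x r => dotp x u = r)) => //; first exact: dotp0l.
by move=> x1 r1 x2 r2 <- <-; exact: dotpDl.
Qed.

Lemma dotpxx_eq0 u : dotp u u = 0 -> u = 0.
Proof.
move=> /eqP; rewrite psumr_eq0; last by move=> i _; exact: sqr_ge0.
move=> /allP u0; apply/matrixP => i j; rewrite ord1 mxE.
by apply/eqP; have := u0 j (mem_index_enum j); rewrite mulf_eq0 orbb.
Qed.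

Lemma sum_continuous (T : topologicalType) (W : normedModType R) (I : Type)
    (s : seq I) (f : I -> T -> W) :
  (forall i, continuous (f i)) -> continuous (fun z => \sum_(i <- s) f i z).
Proof.
move=> fc x; elim: s => [|i s IH].
  under eq_fun do rewrite big_nil.
  exact: cvg_cst.
under eq_fun do rewrite big_cons.
by apply: cvgD => //; exact: fc.
Qed.

Lemma mull_continuous (T : topologicalType) (k : R) (f : T -> R) :
  continuous f -> continuous (fun z => k * f z).
Proof. by move=> fc z; apply: cvgMl_tmp; exact: fc. Qed.

Lemma scaler_continuous (T : topologicalType) (W : normedModType R) (w : W)
    (f : T -> R) :
  continuous f -> continuous (fun z => f z *: w).
Proof. by move=> fc z; apply: cvgZr_tmp; exact: fc. Qed.

Lemma dotp_continuous u : continuous (dotp u).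
Proof.
apply: sum_continuous => i; apply: mull_continuous => x.
exact: coord_continuous.
Qed.

Lemma linear_rV_continuous (W : normedModType R) (f : {linear V -> W}) :
  continuous f.
Proof.
have -> : f = (fun t : V => \sum_j t 0 j *: f (delta_mx 0 j)) :> (V -> W).
  apply/funext => t; rewrite {1}[t]row_sum_delta linear_sum.
  by apply: eq_bigr => j _; rewrite linearZ.
apply: sum_continuous => j; apply: scaler_continuous => x; exact: coord_continuous.
Qed.

Lemma vspace_closed (X : {vspace V}) : closed [set t | t \in X].
Proof.
(* A subspace is the kernel of the identity minus its projection, which is continuous. *)
have -> : [set t | t \in X] = ((\1 - projv X)%VF : V -> V) @^-1` [set 0].
  apply/seteqP; split => t /=; rewrite add_lfunE opp_lfunE id_lfunE.
    by move=> tX; rewrite projv_id // subrr.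
  by move/eqP; rewrite subr_eq0 => /eqP ->; rewrite memv_proj.
apply: preimage_closed; first by move=> t _; exact: linear_rV_continuous.
exact: accessible_closed_set1 (hausdorff_accessible (@norm_hausdorff _ _)) _.
Qed.

End DotProduct.

(** * Critical points of sums of exponentials *)

Section CriticalPoint.
Context {R : realType} {m : nat}.
Local Notation V := 'rV[R]_m.
Variables (I : eqType) (s : seq I) (c : I -> R) (v : I -> V) (X : {vspace V}).
Hypothesis c_gt0 : forall i, i \in s -> 0 < c i.
Hypothesis v_pos : forall u, u \in X -> u != 0 ->
  exists2 i, i \in s & 0 < dotp (v i) u.

Let g t := \sum_(i <- s) c i * expR (dotp (v i) t).
Let M t := \sum_(i <- s) c i * Num.max 0 (dotp (v i) t).

Lemma expsum_continuous : continuous g.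
Proof.
apply: sum_continuous => i; apply: mull_continuous => x.
apply: (@continuous_comp _ _ _ (dotp (v i)) (@expR R)).
  exact: dotp_continuous.
exact: continuous_expR.
Qed.

(** [M] is continuous and positively homogeneous, and [v_pos] makes it positive on the unit sphere
    of [X]. Its minimum on that compact sphere is the constant [e]. *)
Lemma sum_maxr_coercive :
  exists2 e : R, 0 < e & forall t, t \in X -> e * `|t| <= M t.
Proof.
have M_ge0 t : 0 <= M t.
  rewrite /M big_seq; apply: sumr_ge0 => i /c_gt0 /ltW ci.
  by rewrite mulr_ge0 // le_max lexx.
have Mc : continuous M.
  apply: sum_continuous => i; apply: mull_continuous => x.
  apply: (@continuous_max _ _ (fun=> 0) (dotp (v i)) x); first exact: cst_continuous.
  exact: dotp_continuous.
pose A := [set t : V | t \in X] `&` [set t : V | `|t| = 1].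
have scaleA t : t \in X -> t != 0 -> A (`|t|^-1 *: t).
  move=> tX t0; split; first exact: memvZ.
  by rewrite /= normrZ normfV normr_id mulVf // normr_eq0.
(* If the sphere is empty, then [X] is zero and any constant will do. *)
have [[a Aa]|A0] := pselect (A !=set0); last first.
  exists 1 => // t tX; have [->|t0] := eqVneq t 0; first by rewrite normr0 mulr0.
  by case: A0; exists (`|t|^-1 *: t); exact: scaleA.
have Acpt : compact A.
  apply: bounded_closed_compact.
    exists 1; split; first exact: num_real.
    by move=> r r1 t [_ /= ->]; exact: ltW.
  apply: closedI; first exact: vspace_closed.
  apply: (@preimage_closed _ _ (fun t : V => `|t|) [set 1]).
    by move=> t _; exact: norm_continuous.
  exact: accessible_closed_set1 (hausdorff_accessible (@norm_hausdorff _ _)) _.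
have [t0 /set_mem [t0X /= t01] t0min] :=
  EVT_min_rV (ex_intro _ a Aa) Acpt (continuous_subspaceT Mc).
exists (M t0).
  have t0_neq0 : t0 != 0 by rewrite -normr_eq0 t01 oner_neq0.
  have [i si vi] := v_pos t0X t0_neq0.
  rewrite /M (big_rem i) //=; apply: ltr_pwDl.
    by rewrite mulr_gt0 ?c_gt0 // lt_max vi orbT.
  rewrite big_seq; apply: sumr_ge0 => j /mem_rem /c_gt0 /ltW cj.
  by rewrite mulr_ge0 // le_max lexx.
move=> t tX; have [->|tn0] := eqVneq t 0; first by rewrite normr0 mulr0.
have := t0min _ (mem_set (scaleA _ tX tn0)).
have -> : M (`|t|^-1 *: t) = `|t|^-1 * M t.
  rewrite /M mulr_sumr; apply: eq_bigr => i _.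
  rewrite dotpZr mulrCA; congr (_ * _).
  by rewrite -{1}(mulr0 `|t|^-1) maxr_pMr // invr_ge0.
by rewrite mulrC ler_pdivlMr // normr_gt0.
Qed.

(** As [max 0 z <= exp z], [g] dominates the coercive [M]. Hence [g] is at least [g 0] outside the
    ball of radius [g 0 / e], and a minimiser on the compact ball is global on [X]. *)
Lemma expsum_min : exists2 t, t \in X & forall t', t' \in X -> g t <= g t'.
Proof.
have [e e0 eM] := sum_maxr_coercive.
have Mg t : M t <= g t.
  rewrite /M /g big_seq [leRHS]big_seq; apply: ler_sum => i si.
  apply: ler_wpM2l; first exact: ltW (c_gt0 si).
  rewrite ge_max expR_ge0 /=; apply: le_trans (expR_ge1Dx _).
  by rewrite lerDr.
pose A := [set t : V | t \in X] `&` [set t : V | `|t| <= g 0 / e].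
have g0 : 0 <= g 0.
  rewrite /g big_seq; apply: sumr_ge0 => i /c_gt0 /ltW ci.
  by rewrite mulr_ge0 // expR_ge0.
have A0 : A 0 by split; rewrite /= ?mem0v // normr0 divr_ge0 // ltW.
have Acpt : compact A.
  apply: bounded_closed_compact.
    exists (g 0 / e); split; first exact: num_real.
    by move=> r r1 t [_ /= /le_trans]; apply; exact: ltW.
  apply: closedI; first exact: vspace_closed.
  apply: (@preimage_closed _ _ (fun t : V => `|t|) [set r | r <= g 0 / e]).
    by move=> t _; exact: norm_continuous.
  exact: closed_le.
have [t0 /set_mem [t0X _] t0min] :=
  EVT_min_rV (ex_intro _ 0 A0) Acpt (continuous_subspaceT expsum_continuous).
exists t0 => // t tX.
have [tA|tA] := leP `|t| (g 0 / e); first exact/t0min/mem_set.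
apply: le_trans (t0min _ (mem_set A0)) _.
move: tA; rewrite ltr_pdivrMr // => /ltW /le_trans; apply.
by rewrite mulrC; apply: le_trans (eM _ tX) (Mg _).
Qed.

Hypothesis vX : forall i, i \in s -> v i \in X.

(** The gradient [w] at a minimiser lies in [X], so a step along [- w] stays in [X]. Minimality then
    forces [dotp w w <= 0]. *)
Lemma expsum_critical_point : exists2 t, t \in X &
  \sum_(i <- s) (c i * expR (dotp (v i) t)) *: v i = 0.
Proof.
have [t tX tmin] := expsum_min; exists t => //.
set w := \sum_(i <- s) _.
have wX : w \in X by rewrite /w big_seq; apply: memv_suml => i si; exact/memvZ/vX.
apply: dotpxx_eq0; apply/eqP; rewrite eq_le; apply/andP; split; last first.
  by apply: sumr_ge0 => i _; exact: sqr_ge0.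
(* [psi r] pairs the gradient at [t - r *: w] with [w]. It is shown to be nonpositive for [r > 0],
   and continuity carries this to [r = 0]. *)
pose psi r := \sum_(i <- s) c i * expR (dotp (v i) (t - r *: w)) * dotp (v i) w.
have -> : dotp w w = psi 0.
  rewrite {1}/w dotp_suml /psi scale0r subr0.
  by apply: eq_bigr => i _; rewrite dotpZl.
(* Minimality at [t] against the tangent inequality at [t - r w]. *)
have psi_le0 r : 0 < r -> psi r <= 0.
  move=> r0; rewrite -(pmulr_rle0 _ r0).
  have tr : t - r *: w \in X by rewrite memvB // memvZ.
  have tr_min := tmin _ tr; rewrite -subr_le0 in tr_min; apply: le_trans tr_min.
  rewrite /psi /g -sumrB mulr_sumr big_seq [leRHS]big_seq; apply: ler_sum => i si.
  have -> : dotp (v i) t = dotp (v i) (t - r *: w) + r * dotp (v i) w.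
    by rewrite -dotpZr -dotpDr subrK.
  set p := dotp _ (t - _); set q := dotp _ w.
  rewrite expRD mulrA -[X in _ - X]mulr1 -mulrBr mulrCA ler_pM2l.
    by rewrite lerBrDl expR_ge1Dx.
  by rewrite mulr_gt0 ?expR_gt0 ?c_gt0.
have psic : continuous psi.
  have -> : psi = fun r => \sum_(i <- s) (c i * expR (dotp (v i) t) * dotp (v i) w)
      * expR (- dotp (v i) w * r).
    apply/funext => r; apply: eq_bigr => i _.
    by rewrite dotpBr dotpZr expRD -mulNr [- _ * _]mulrC mulrN mulNr; ring.
  apply: sum_continuous => i; apply: mull_continuous => r.
  apply: (@continuous_comp _ _ _ (fun r => - dotp (v i) w * r) (@expR R)).
    exact: mulrl_continuous.
  exact: continuous_expR.
have psi0 : psi x @[x --> 0^'+] --> psi 0 by apply: cvg_at_right_filter; exact: psic.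
apply: (cvgr_to_le psi0); near=> r; apply: psi_le0; near: r.
exact: nbhs_right_gt.
Unshelve. all: by end_near. Qed.

End CriticalPoint.

(** * Convex hulls and faces *)

Section ConvexHull.
Context {R : realType} {m : nat}.
Local Notation V := 'rV[R]_m.
Implicit Types (B : {fset V}) (x y z u a : V) (h : R).

Lemma dotp_span_eq0 (s : seq V) u :
  (forall v, v \in s -> dotp v u = 0) ->
  forall x, x \in span s -> dotp x u = 0.
Proof.
move=> su x xs; rewrite (@coord_span _ _ _ (in_tuple s) x) // dotp_suml.
by apply: big1 => i _; rewrite dotpZl su ?mulr0 //; exact: mem_nth.
Qed.

(** The sum of all ratios bounds each of them, and the extra 1 makes the inequality strict. Such an
    [N] combines two functionals lexicographically. *)
Lemma large_multiple_lt0 (I : eqType) (s : seq I) (p q : I -> R) :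
  exists2 N, 0 < N & forall i, i \in s -> p i < 0 -> N * p i + q i < 0.
Proof.
exists (1 + \sum_(i <- s) `|q i| / `|p i|).
  by rewrite ltr_pwDl // sumr_ge0 // => i _; rewrite divr_ge0.
move=> i si pi0; rewrite -ltrBrDr sub0r -ltrN2 opprK -mulrN -ltr0_norm //.
apply: le_lt_trans (ler_norm _) _.
rewrite -ltr_pdivrMr ?normr_gt0 ?lt_eqF //.
rewrite (big_rem i) //= addrCA ltrDl.
apply: ltr_pwDl => //; apply: sumr_ge0 => j _; exact: divr_ge0.
Qed.

(* Either the minimisation problem is coercive and its critical point gives
   positive weights on all of [B], or a direction of non-coercivity supports a
   proper face, on which one recurses. *)
Lemma strict_complementarity B y : exists u,
  (forall a, a \in B -> dotp u (a - y) <= 0) /\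
  exists w : V -> R,
    (forall a, a \in B -> dotp u (a - y) = 0 -> 0 < w a) /\
    \sum_(a <- [fset a in B | dotp u (a - y) == 0]%fset) w a *: (a - y) = 0.
Proof.
elim: {B}#|`B|.+1 {-2}B (ltnSn #|`B|) => // n IH B leBn.
pose X := <<[seq a - y | a <- B]>>%VS.
have [H|] := pselect (forall u, u \in X -> u != 0 ->
    exists2 a, a \in enum_fset B & 0 < dotp (a - y) u).
  have memX a : a \in enum_fset B -> a - y \in X.
    by move=> aB; exact/memv_span/map_f.
  have [|t _ t0] := @expsum_critical_point R m _ _ (fun=> 1) (fun a => a - y) _ _ H memX.
    by [].
  exists 0; split; first by move=> a _; rewrite dotp0l.
  exists (fun a => 1 * expR (dotp (a - y) t)); split.
    by move=> a _ _; rewrite mul1r expR_gt0.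
  rewrite (_ : [fset _ in _ | _]%fset = B) //.
  by apply/fsetP => a; rewrite !inE dotp0l eqxx andbT.
move=> /existsNP[u /not_implyP[uX /not_implyP[u0 Hu]]].
have ule0 a : a \in B -> dotp u (a - y) <= 0.
  by move=> aB; rewrite leNgt; apply/negP => ua; apply: Hu; exists a; rewrite // dotpC.
(* A nonzero vector of the span is not orthogonal to every generator. So the set [B'] of points
   orthogonal to [u] after the shift is strictly smaller than [B]. *)
have [a1 a1B ua1] : exists2 a, a \in B & dotp u (a - y) != 0.
  apply: contrapT => H; move/eqP: u0; apply; apply: dotpxx_eq0.
  apply: dotp_span_eq0 uX => _ /mapP[a aB ->]; rewrite dotpC.
  by apply: contrapT => /eqP ua; apply: H; exists a.
pose B' := [fset a in B | dotp u (a - y) == 0]%fset.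
have ltB' : (#|`B'| < n)%N.
  move: leBn; rewrite ltnS; apply: leq_trans; apply: fproper_ltn_card.
  rewrite fproperE; apply/andP; split.
    by apply/fsubsetP => a; rewrite !inE => /andP[].
  by apply/negP => /fsubsetP /(_ a1 a1B); rewrite !inE a1B (negPf ua1).
have [u' [u'le0 [w [w0 ws]]]] := IH _ ltB'.
(* In [N *: u + u'] the sign of [u] decides off [B'] and that of [u'] decides on [B']. The new zero
   set is thus the one produced by the recursion. *)
have [N N0 HN] := large_multiple_lt0 (enum_fset B) (fun a => dotp u (a - y))
  (fun a => dotp u' (a - y)).
have uu' a : dotp (N *: u + u') (a - y) = N * dotp u (a - y) + dotp u' (a - y).
  by rewrite dotpDl dotpZl.
have B'P a : (a \in B) && (dotp (N *: u + u') (a - y) == 0) =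
    (a \in B') && (dotp u' (a - y) == 0).
  rewrite uu' !inE; case: (boolP (a \in B)) => //= aB.
  have [->|ua] := eqVneq (dotp u (a - y)) 0; first by rewrite mulr0 add0r.
  by rewrite lt_eqF // HN // lt_neqAle ua ule0.
exists (N *: u + u'); split.
  move=> a aB; rewrite uu'; have [ua|ua] := eqVneq (dotp u (a - y)) 0.
    by rewrite ua mulr0 add0r u'le0 // !inE aB ua eqxx.
  by apply: ltW; rewrite HN // lt_neqAle ua ule0.
exists w; split.
  move=> a aB /eqP ua; have := B'P a; rewrite aB ua => /esym/andP[aB' /eqP].
  exact: w0.
rewrite -[RHS]ws; congr (\sum_(a <- enum_fset _) _).
by apply/fsetP => a; have := B'P a; rewrite !inE.
Qed.

(** Strict positivity of all weights is an algebraic description of the relative interior of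
    [conv_hull B], as [relint_conv_hull] shows. *)
Definition pos_hull B : set V :=
  [set x | exists w : V -> R,
    [/\ forall a, a \in B -> 0 < w a,
        \sum_(a <- B) w a = 1
      & x = \sum_(a <- B) w a *: a]].

Lemma sum_scaleB (w : V -> R) B y :
  \sum_(a <- B) w a *: (a - y) =
  \sum_(a <- B) w a *: a - (\sum_(a <- B) w a) *: y.
Proof. by rewrite scaler_suml -sumrB; apply: eq_bigr => a _; rewrite scalerBr. Qed.

Lemma fset_sum_gt0 B (w : V -> R) : B != fset0 ->
  (forall a, a \in B -> 0 < w a) -> 0 < \sum_(a <- B) w a.
Proof.
move=> /fset0Pn[b bB] w0; rewrite (big_fsetD1 b) //=.
rewrite ltr_pwDl ?w0 // big_seq sumr_ge0 // => a.
by rewrite !inE => /andP[_ /w0 /ltW].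
Qed.

Lemma pos_hull_balanced B (w : V -> R) y : B != fset0 ->
  (forall a, a \in B -> 0 < w a) ->
  \sum_(a <- B) w a *: (a - y) = 0 -> pos_hull B y.
Proof.
move=> B0 w0; have W0 := fset_sum_gt0 B0 w0.
rewrite sum_scaleB; set W := \sum_(a <- B) w a in W0 *.
move=> /eqP; rewrite subr_eq0 => /eqP wy.
exists (fun a => W^-1 * w a); split.
- by move=> a /w0 wa; rewrite mulr_gt0 ?invr_gt0.
- by rewrite -mulr_sumr mulVf ?gt_eqF.
- under eq_bigr do rewrite -scalerA.
  by rewrite -scaler_sumr wy scalerA mulVf ?scale1r ?gt_eqF.
Qed.

Lemma pos_hull_conv B : pos_hull B `<=` conv_hull B.
Proof. by move=> x [w [w0 w1 ->]]; exists w; split => // a /w0 /ltW. Qed.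

Lemma conv_hull_mono B B' : (B `<=` B')%fset -> conv_hull B `<=` conv_hull B'.
Proof.
move=> sBB' x [w [w0 w1 ->]]; exists (fun a => if a \in B then w a else 0); split.
- by move=> a _; case: ifP => // /w0.
- rewrite -w1 -(big_fset_incl _ sBB'); last by move=> a _ /negPf ->.
  by rewrite big_seq [RHS]big_seq; apply: eq_bigr => a ->.
- rewrite -(big_fset_incl _ sBB'); last by move=> a _ /negPf ->; rewrite scale0r.
  by rewrite big_seq [RHS]big_seq; apply: eq_bigr => a ->.
Qed.

Lemma mem_conv_hull B a : a \in B -> conv_hull B a.
Proof.
move=> aB; apply: (@conv_hull_mono [fset a]%fset); first by rewrite fsub1set.
by exists (fun=> 1); split=> //; rewrite big_seq_fset1 ?scale1r.
Qed.

Lemma dotp_conv_le B u h z : (forall a, a \in B -> dotp u a <= h) ->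
  conv_hull B z -> dotp u z <= h.
Proof.
move=> uh [w [w0 w1 ->]]; rewrite dotpC dotp_suml -[h]mul1r -w1 mulr_suml.
rewrite big_seq [leRHS]big_seq; apply: ler_sum => a aB.
by rewrite dotpZl dotpC ler_wpM2l ?w0 ?uh.
Qed.

(** If some inequality of [strict_complementarity] were an equality, the balanced positive weights,
    once normalised, would place [y] in the hull. *)
Lemma conv_hull_separation B y : ~ conv_hull B y ->
  exists u, forall a, a \in B -> dotp u a < dotp u y.
Proof.
have [u [ule0 [w [w0 ws]]]] := strict_complementarity B y => nBy.
exists u => a aB; rewrite -subr_lt0 -dotpBr lt_neqAle ule0 // andbT.
apply/negP => ua; apply: nBy.
set B' := [fset a in B | _]%fset in ws.
apply: (@conv_hull_mono B'); first by apply/fsubsetP => b; rewrite inE => /andP[].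
apply: pos_hull_conv; apply: pos_hull_balanced ws.
  by apply/fset0Pn; exists a; rewrite !inE aB.
by move=> b; rewrite !inE => /andP[bB /eqP]; exact: w0.
Qed.

(** The balanced weights of [strict_complementarity] exhibit [y] as a relative interior point of the
    face where [u] is maximal. *)
Lemma conv_hull_face_at B y : conv_hull B y -> exists u h,
  (forall a, a \in B -> dotp u a <= h) /\
  pos_hull [fset a in B | dotp u a == h]%fset y.
Proof.
have [u [ule0 [w [w0 ws]]]] := strict_complementarity B y => -[v [v0 v1 vy]].
exists u, (dotp u y); split.
  by move=> a aB; rewrite -subr_le0 -dotpBr ule0.
have -> : [fset a in B | dotp u a == dotp u y]%fset =
    [fset a in B | dotp u (a - y) == 0]%fset.
  by apply/fsetP => a; rewrite !inE dotpBr subr_eq0.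
apply: pos_hull_balanced ws; last first.
  by move=> b; rewrite !inE => /andP[bB /eqP]; exact: w0.
(* The zero set is nonempty: otherwise pairing a convex representation of [y] with [u] would make a
   sum of nonpositive terms vanish, so all weights would be zero. *)
apply/negP => /eqP B0.
have ult0 a : a \in B -> dotp u (a - y) < 0.
  move=> aB; rewrite lt_neqAle ule0 // andbT; apply/negP => ua.
  by have : a \in fset0 by rewrite -B0 !inE aB.
have : \sum_(a <- B) v a * dotp u (a - y) = 0.
  transitivity (dotp (\sum_(a <- B) v a *: (a - y)) u).
    by rewrite dotp_suml; apply: eq_bigr => a _; rewrite dotpZl dotpC.
  by rewrite sum_scaleB v1 -vy scale1r subrr dotp0l.
move/eqP; rewrite -oppr_eq0 -sumrN big_seq psumr_eq0; last first.
  by move=> a aB; rewrite -mulrN mulr_ge0 ?v0 // oppr_ge0 ule0.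
move=> /allP vu0; move: v1; rewrite big_seq big1.
  by move/eqP; rewrite eq_sym oner_eq0.
move=> a aB; have := vu0 a aB; rewrite aB /= oppr_eq0 mulf_eq0.
by rewrite [X in _ || X]lt_eqF ?ult0 // orbF => /eqP.
Qed.

(** The slacks [h - dotp u a] are nonnegative and their weighted sum vanishes on the hyperplane, so
    only points without slack carry weight. *)
Lemma conv_hull_faceE B u h : (forall a, a \in B -> dotp u a <= h) ->
  [set z | conv_hull B z /\ dotp u z = h] =
  conv_hull [fset a in B | dotp u a == h]%fset.
Proof.
move=> uh; apply/seteqP; split => z /=.
  move=> [[w [w0 w1 zw]] uz].
  have wu0 a : a \in B -> dotp u a != h -> w a = 0.
    move=> aB uah; apply/eqP.
    have : \sum_(a <- B) w a * (h - dotp u a) = 0.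
      under eq_bigr do rewrite mulrBr.
      rewrite sumrB -mulr_suml w1 mul1r -uz zw dotpC dotp_suml.
      by under eq_bigr do rewrite dotpZl dotpC; rewrite subrr.
    move/eqP; rewrite big_seq psumr_eq0; last first.
      by move=> b bB; rewrite mulr_ge0 ?w0 // subr_ge0 uh.
    move=> /allP /(_ a aB); rewrite aB mulf_eq0 subr_eq0 [h == _]eq_sym (negPf uah).
    by rewrite orbF.
  set B' := [fset a in B | _]%fset.
  have sB : (B' `<=` B)%fset by apply/fsubsetP => a; rewrite !inE => /andP[].
  have nB a : a \in B -> a \notin B' -> w a = 0.
    by move=> aB; rewrite !inE aB /= => /wu0; exact.
  exists w; split; first by move=> a /(fsubsetP sB); exact: w0.
    by rewrite (big_fset_incl _ sB).
  by rewrite (big_fset_incl _ sB) // => a aB /nB ->; rewrite // scale0r.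
move=> Bz; split.
  by apply: conv_hull_mono Bz; apply/fsubsetP => a; rewrite !inE => /andP[].
apply/eqP; rewrite eq_le; apply/andP; split.
  by apply: dotp_conv_le Bz => a; rewrite !inE => /andP[_ /eqP ->].
rewrite -lerN2 -[leLHS]mulN1r -[leRHS]mulN1r -dotpZl.
by apply: dotp_conv_le Bz => a; rewrite !inE => /andP[_ /eqP <-]; rewrite dotpZl.
Qed.

Lemma conv_hull_closed B : closed (conv_hull B).
Proof.
move=> y Cy; apply: contrapT => /conv_hull_separation[u uB].
(* Finiteness of [B] leaves a gap between [h] and [dotp u y]. The initial value covers empty [B] and
   stays below [dotp u y]. *)
pose h := \big[Num.max/dotp u y - 1]_(a <- B) dotp u a.
have hy : h < dotp u y.
  rewrite /h big_seq; apply: (big_ind (fun r => r < dotp u y)) => //.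
    by rewrite ltrBlDr ltrDl.
  by move=> a b ay yb; rewrite gt_max ay.
have Bh a : a \in B -> dotp u a <= h by move=> aB; exact: le_bigmax_seq.
have clh : closed (dotp u @^-1` [set r | r <= h]).
  apply: preimage_closed; last exact: closed_le.
  by move=> t _; exact: dotp_continuous.
have /clh /= : closure (dotp u @^-1` [set r | r <= h]) y.
  by apply: closureS Cy => z /=; exact: dotp_conv_le.
by rewrite leNgt hy.
Qed.

End ConvexHull.

(** * Relative interior and closure of convex hulls *)

Section RelativeInterior.
Context {R : realType} {m : nat}.
Local Notation V := 'rV[R]_m.
Implicit Types (B : {fset V}) (x y z u a : V) (h : R).

Lemma span_coords B (f : V -> V) : exists l : V -> V -> R,
  [/\ forall a, continuous (l a),
      forall a, {morph l a : x y / x - y}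
    & forall z, z \in <<[seq f a | a <- B]>>%VS ->
        z = \sum_(a <- B) l a z *: f a].
Proof.
set s := in_tuple [seq f a | a <- B].
(* The family may have repeated or dependent vectors, so [coord] is indexed by positions. The
   indicator selects the unique position of [a] in [B]. *)
exists (fun a z => \sum_(i < size [seq f a | a <- B]) ((B : seq V)`_i == a)%:R * coord s i z); split.
- move=> a; apply: sum_continuous => i; apply: mull_continuous.
  exact: (@linear_rV_continuous R m R^o (coord s i)).
- move=> a x y; rewrite -sumrB; apply: eq_bigr => i _.
  by rewrite linearB -mulrBr.
- move=> z zs; rewrite {1}(@coord_span _ _ _ s z) //.
  under [RHS]eq_bigr do rewrite scaler_suml.
  rewrite exchange_big /=; apply: eq_bigr => i _.
  have iB : (i < size B)%N by apply: leq_trans (ltn_ord i) _; rewrite size_map.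
  rewrite (nth_map 0) // (big_fsetD1 ((B : seq V)`_i)) /=; last exact: mem_nth.
  rewrite eqxx mul1r big_seq big1 ?addr0 // => a.
  by rewrite !inE => /andP[/negPf na _]; rewrite eq_sym na mul0r scale0r.
Qed.

Lemma pos_hull_nonempty B : B != fset0 -> pos_hull B !=set0.
Proof.
move=> B0; pose W : R := \sum_(a <- B) 1.
have W0 : 0 < W by apply: fset_sum_gt0.
exists (W^-1 *: \sum_(a <- B) a); apply: (@pos_hull_balanced _ _ _ (fun=> 1)) => //.
rewrite sum_scaleB -/W scalerA divff ?gt_eqF // scale1r.
by under eq_bigr do rewrite scale1r; rewrite subrr.
Qed.

Lemma conv_hull_neq0 B x : conv_hull B x -> B != fset0.
Proof.
move=> [w [_ w1 _]]; apply/eqP => B0; move: w1.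
by rewrite B0 big_seq_fset0 => /eqP; rewrite eq_sym oner_eq0.
Qed.

Lemma aff_hull_line (A : set V) x y (r : R) :
  A x -> A y -> aff_hull A (x + r *: (x - y)).
Proof.
move=> Ax Ay; exists 2%N, (fun i : 'I_2 => if i == ord0 then x else y),
  (fun i : 'I_2 => if i == ord0 then 1 + r else - r); split.
- by move=> i; case: ifP.
- by rewrite !big_ord_recl big_ord0 /= addr0 addrK.
- rewrite !big_ord_recl big_ord0 /= addr0 scalerDl scale1r scaleNr scalerBr.
  by rewrite addrA.
Qed.

Lemma aff_hull_conv_sub B x z : conv_hull B x -> aff_hull (conv_hull B) z ->
  z - x \in <<[seq a - x | a <- B]>>%VS.
Proof.
move=> Bx [n [p [w [pB w1 ->]]]].
rewrite -[x in X in X \in _]scale1r -w1 scaler_suml -sumrB.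
apply: memv_suml => i _; rewrite -scalerBr; apply: memvZ.
have [v [v0 v1 ->]] := pB i; rewrite -[x in X in X \in _]scale1r -v1 -sum_scaleB.
by rewrite big_seq; apply: memv_suml => a aB; exact/memvZ/memv_span/map_f.
Qed.

(** For [z] near [x] in the affine hull, the positive weights of [x] are corrected by the small
    coordinates of [z - x], and remain nonnegative. *)
Lemma pos_hull_relint B : pos_hull B `<=` relint (conv_hull B).
Proof.
move=> x Bx; have cBx := pos_hull_conv Bx; split=> //.
have [w [w0 w1 xw]] := Bx.
have [l [lc lB lz]] := span_coords B (fun a => a - x).
(* The corrected weight of [a] is [w a + G a z - G a x]. Subtracting the multiple of [w a] keeps the
   total equal to 1. *)
pose G a z := l a z - w a * \sum_(b <- B) l b z.
have Gc a : continuous (G a).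
  have lwc : continuous (fun z => w a * \sum_(b <- B) l b z).
    by apply: mull_continuous; exact: sum_continuous.
  by move=> z; exact: continuousB (lc a z) (lwc z).
have near_a (a : B) : \forall z \near x, G (val a) x - w (val a) < G (val a) z.
  apply: (@cvgr_gt R V (nbhs x) (nbhs_filter x) _ _ (Gc (val a) x)).
  by rewrite ltrBlDr ltrDl w0 //; exact: fsvalP.
have near_x := filter_forall (nbhs_filter x) near_a.
near_simpl; rewrite near_withinE.
near=> z => affz; pose t := \sum_(b <- B) l b (z - x).
have zx := lz _ (aff_hull_conv_sub cBx affz).
exists (fun a => w a + l a (z - x) - t * w a); split.
- move=> a aB; have : forall a : B, G (val a) x - w (val a) < G (val a) z by near: z.
  move=> /(_ [` aB]%fset) /=; rewrite /G.
  have -> : t = \sum_(b <- B) l b z - \sum_(b <- B) l b x.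
    by rewrite -sumrB; apply: eq_bigr => b _; rewrite lB.
  rewrite lB; move: (\sum_(b <- B) l b z) (\sum_(b <- B) l b x) => p q pq.
  by apply/ltW; nra.
- by rewrite sumrB big_split /= -mulr_sumr w1 mulr1 addrK.
- rewrite -[LHS](subrK x) {1}zx sum_scaleB -/t.
  under [RHS]eq_bigr do rewrite scalerBl scalerDl -scalerA.
  rewrite sumrB big_split /= -scaler_sumr -xw.
  by rewrite addrAC [x + _]addrC.
Unshelve. all: by end_near. Qed.

(** For the converse, [x] is pushed slightly away from some [b] in [pos_hull B]. It is then a convex
    combination of the pushed point and [b], with positive weight on [b]. *)
Lemma relint_conv_hull B : relint (conv_hull B) = pos_hull B.
Proof.
apply/seteqP; split; last exact: pos_hull_relint.
move=> x [cBx]; rewrite near_withinE => /nbhs_normP[e /= e0 xe].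
have [b Bb] := pos_hull_nonempty (conv_hull_neq0 cBx).
(* This gives a displacement of norm below [e], even when [x] equals [b]. *)
pose r := e / (e + `|x - b|).
have eb0 : 0 < e + `|x - b| by rewrite ltr_pwDl.
have r0 : 0 < r by rewrite divr_gt0.
have [v [v0 v1 vz]] : conv_hull B (x + r *: (x - b)).
  apply: xe; last by apply: aff_hull_line => //; exact: pos_hull_conv.
  rewrite /= opprD addNKr normrN normrZ gtr0_norm // /r mulrAC ltr_pdivrMr //.
  by rewrite mulrDr ltrDr mulr_gt0.
have [w [w0 w1 bw]] := Bb.
have r1 : 1 + r != 0 by rewrite gt_eqF // addr_gt0.
exists (fun a => (1 + r)^-1 * (v a + r * w a)); split.
- move=> a aB; apply: mulr_gt0; first by rewrite invr_gt0 addr_gt0.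
  by rewrite ltr_wpDl ?v0 // mulr_gt0 ?w0.
- by rewrite -mulr_sumr big_split /= -mulr_sumr v1 w1 mulr1 mulVf.
- under eq_bigr do rewrite -scalerA scalerDl -scalerA.
  rewrite -scaler_sumr big_split /= -scaler_sumr -vz -bw scalerBr addrA subrK.
  by rewrite -{2}[x]scale1r -scalerDl scalerA mulVf ?scale1r.
Qed.

(** Every point of the hull is a limit of points on the segment towards some [b] in [pos_hull B];
    these have positive weights. *)
Lemma closure_pos_hull B : B != fset0 -> closure (pos_hull B) = conv_hull B.
Proof.
move=> B0; apply/seteqP; split.
  rewrite (closure_id (conv_hull B)).1; last exact: conv_hull_closed.
  by apply: closureS; exact: pos_hull_conv.
move=> y [v [v0 v1 vy]] U /nbhs_normP[e /= e0 Ue].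
have [b Bb] := pos_hull_nonempty B0; have [w [w0 w1 bw]] := Bb.
pose r := e / (e + `|b - y|).
have eb0 : 0 < e + `|b - y| by rewrite ltr_pwDl.
have r0 : 0 < r by rewrite divr_gt0.
have r1 : r <= 1 by rewrite ler_pdivrMr // mul1r lerDl.
exists (y + r *: (b - y)); split; last first.
  apply: Ue; rewrite /= opprD addNKr normrN normrZ gtr0_norm // /r mulrAC.
  by rewrite ltr_pdivrMr // mulrDr ltrDr mulr_gt0.
exists (fun a => (1 - r) * v a + r * w a); split.
- move=> a aB; rewrite ltr_wpDl ?mulr_ge0 ?v0 ?subr_ge0 //.
  by rewrite mulr_gt0 ?w0.
- by rewrite big_split /= -!mulr_sumr v1 w1 !mulr1 subrK.
- under eq_bigr do rewrite scalerDl -(scalerA (1 - r)) -(scalerA r).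
  rewrite big_split /= -!scaler_sumr -vy -bw scalerBl scale1r scalerBr.
  by rewrite addrA addrAC.
Qed.

End RelativeInterior.

(** * Faces of a polytope and the finite sets spanning them *)

Section Faces.
Context {R : realType} {m : nat}.
Local Notation V := 'rV[R]_m.
Implicit Types (B S : {fset V}) (K L : set V) (x y z u a : V) (h : R).

Lemma relopen_face_conv_hullP S K : relopen_face (conv_hull S) K ->
  exists u h, let B := [fset a in S | dotp u a == h]%fset in
    [/\ forall a, a \in S -> dotp u a <= h,
        B != fset0, K = pos_hull B & closure K = conv_hull B].
Proof.
move=> [F [[[f Ff] [u [h [uh FE]]]] ->]]; exists u, h => B.
have uS a : a \in S -> dotp u a <= h by move=> aS; exact/uh/mem_conv_hull.
have FB : F = conv_hull B by rewrite FE conv_hull_faceE.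
have B0 : B != fset0 by apply: (@conv_hull_neq0 _ _ _ f); rewrite -FB.
split=> //; first by rewrite FB relint_conv_hull.
by rewrite FB relint_conv_hull closure_pos_hull.
Qed.

(** A weighted average with all weights positive reaches the upper bound only if every term does. *)
Lemma pos_hull_dotp_eq B u h x : (forall a, a \in B -> dotp u a <= h) ->
  pos_hull B x -> dotp u x = h -> forall a, a \in B -> dotp u a = h.
Proof.
move=> uh [w [w0 w1 ->]] ux a aB.
have : \sum_(a <- B) w a * (h - dotp u a) = 0.
  under eq_bigr do rewrite mulrBr.
  rewrite sumrB -mulr_suml w1 mul1r -{1}ux dotpC dotp_suml.
  by under eq_bigr do rewrite dotpZl dotpC; rewrite subrr.
move/eqP; rewrite big_seq psumr_eq0; last first.
  by move=> b bB; rewrite mulr_ge0 ?(ltW (w0 _ _)) // subr_ge0 uh.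
move=> /allP /(_ a aB); rewrite aB mulf_eq0 gt_eqF ?w0 //= subr_eq0.
by move/eqP => <-.
Qed.

(** The functional defining [F'] is maximal at a relative interior point of [F], hence constant on
    [F]. Used both ways, this makes the face of a point unique. *)
Lemma closed_face_relint_sub S F F' x :
  closed_face (conv_hull S) F -> closed_face (conv_hull S) F' ->
  relint F x -> F' x -> F `<=` F'.
Proof.
move=> [_ [u [h [uh FE]]]] [_ [u' [h' [uh' F'E]]]].
have FB : F = conv_hull [fset a in S | dotp u a == h]%fset.
  by rewrite FE conv_hull_faceE // => a /mem_conv_hull /uh.
move: FB; set B := [fset a in S | _]%fset => FB.
rewrite FB relint_conv_hull => Bx; rewrite F'E => -[_ u'x] z Bz.
have sBS : (B `<=` S)%fset by apply/fsubsetP => a; rewrite !inE => /andP[].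
have u'B a : a \in B -> dotp u' a <= h'.
  by move=> /(fsubsetP sBS) /mem_conv_hull /uh'.
split; first exact: conv_hull_mono sBS _ Bz.
have : conv_hull [fset a in B | dotp u' a == h']%fset z.
  rewrite (_ : [fset _ in _ | _]%fset = B) //; apply/fsetP => a.
  rewrite !inE; apply/andb_idr => aB; apply/eqP.
  by apply: (pos_hull_dotp_eq u'B Bx u'x); rewrite !inE.
by rewrite -conv_hull_faceE // => -[].
Qed.

Lemma face_at_unique S K x :
  relopen_face (conv_hull S) K -> K x -> face_at (conv_hull S) x = K.
Proof.
move=> KS Kx; apply: xget_unique => // K' [[F' [F'S K'E]] K'x].
have [F [FS KE]] := KS; rewrite K'E KE; congr relint.
move: K'x Kx; rewrite K'E KE => F'x Fx.
apply/seteqP; split.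
  exact: closed_face_relint_sub F'S FS F'x Fx.1.
exact: closed_face_relint_sub FS F'S Fx F'x.1.
Qed.

Lemma face_atP B y : conv_hull B y ->
  relopen_face (conv_hull B) (face_at (conv_hull B) y) /\
  face_at (conv_hull B) y y.
Proof.
move=> By.
suff : exists K, relopen_face (conv_hull B) K /\ K y by move/(xgetPex set0).
have [u [h [uh Ly]]] := conv_hull_face_at By.
exists (relint (conv_hull [fset a in B | dotp u a == h]%fset)).
split; last by rewrite /= relint_conv_hull.
exists (conv_hull [fset a in B | dotp u a == h]%fset); split=> //; split.
  by exists y; exact: pos_hull_conv.
exists u, h; split; first by move=> z; exact: dotp_conv_le.
by rewrite conv_hull_faceE.
Qed.

Lemma in_fset_filter B (p : pred V) a :
  (a \in [fset b in B | p b]%fset) = (a \in B) && p a.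
Proof. by rewrite !inE. Qed.

Lemma in_pts S K a : (a \in pts S K) = (a \in S) && (a \in closure K).
Proof. by rewrite !inE. Qed.

(** Needed because [delta_ext] takes faces of [closure K] rather than of the whole polytope. *)
Lemma pts_face S B K L u h : pts S K = B -> closure K = conv_hull B ->
  (forall a, a \in B -> dotp u a <= h) ->
  closure L = conv_hull [fset a in B | dotp u a == h]%fset ->
  pts S L = [fset a in B | dotp u a == h]%fset.
Proof.
move=> KB cK uh; rewrite -conv_hull_faceE // => cL.
apply/fsetP => a; rewrite in_pts cL in_fset_filter -KB in_pts cK KB -andbA.
congr andb; apply/idP/andP.
  by move=> /set_mem[Ba ua]; split; [exact/mem_set|exact/eqP].
by move=> [/set_mem Ba /eqP ua]; apply/mem_set.
Qed.

Lemma pts_closure_conv_hull S K u h :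
  (forall a, a \in S -> dotp u a <= h) ->
  closure K = conv_hull [fset a in S | dotp u a == h]%fset ->
  pts S K = [fset a in S | dotp u a == h]%fset.
Proof.
move=> uh; rewrite -conv_hull_faceE // => cK.
apply/fsetP => a; rewrite in_pts cK in_fset_filter.
case: (boolP (a \in S)) => //= aS; apply/idP/idP.
  by move=> /set_mem[_ ua]; exact/eqP.
by move=> /eqP ua; apply/mem_set; split=> //; exact: mem_conv_hull.
Qed.

End Faces.

(** * The moment map and the Legendre transform *)

Section MomentMap.
Context {R : realType} {m : nat}.
Local Notation V := 'rV[R]_m.
Variables (S : {fset V}) (c : V -> R) (K : set V).
Hypothesis c_gt0 : forall a, a \in pts S K -> 0 < c a.
Hypothesis pts_neq0 : pts S K != fset0.
Implicit Types (x y t a : V).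

Lemma chi_gt0 t : 0 < chi S c K t.
Proof. by apply: fset_sum_gt0 => // a aK; rewrite mulr_gt0 ?c_gt0 ?expR_gt0. Qed.

(** At a critical point of the sum of [c a * exp <a - y, t>] over [dirspace S K], the vanishing
    gradient says that the tilted mean is [y]. *)
Lemma mu_surj y : pos_hull (pts S K) y ->
  exists2 t, t \in dirspace S K & mu S c K t = y.
Proof.
move=> Ky; have [w [w0 w1 yw]] := Ky.
have w_bal : \sum_(a <- pts S K) w a *: (a - y) = 0.
  by rewrite sum_scaleB w1 scale1r -yw subrr.
have dirB a b : a \in pts S K -> b \in pts S K -> a - b \in dirspace S K.
  by move=> aK bK; apply: memv_span; apply/allpairsP; exists (a, b).
(* A direction violating this is maximal at [y], hence constant on the points. It is then orthogonal
   to [dirspace S K], to which it belongs. *)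
have v_pos u : u \in dirspace S K -> u != 0 ->
    exists2 a, a \in enum_fset (pts S K) & 0 < dotp (a - y) u.
  move=> uX u0; apply: contrapT => nu; move/eqP: u0; apply.
  have ule a : a \in pts S K -> dotp u a <= dotp u y.
    move=> aK; rewrite -subr_le0 -dotpBr dotpC leNgt; apply/negP => ua.
    by apply: nu; exists a.
  have ueq := pos_hull_dotp_eq ule Ky erefl.
  apply: dotpxx_eq0; apply: dotp_span_eq0 uX => _ /allpairsP[[a b] /= [aK bK ->]].
  by rewrite dotpC dotpBr !ueq // subrr.
have vX a : a \in enum_fset (pts S K) -> a - y \in dirspace S K.
  move=> aK; rewrite -[a]scale1r -w1 yw scaler_suml -sumrB big_seq.
  by apply: memv_suml => b bK; rewrite -scalerBr memvZ // dirB.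
have [t tX t0] := expsum_critical_point c_gt0 v_pos vX.
exists t => //.
have : \sum_(a <- pts S K) (c a * expR (dotp a t)) *: (a - y) = 0.
  rewrite -[RHS](scaler0 _ (expR (dotp y t))) -[in RHS]t0 scaler_sumr.
  apply: eq_bigr => a _; rewrite scalerA dotpBl expRD expRN.
  by congr (_ *: _); field; rewrite gt_eqF ?expR_gt0.
rewrite sum_scaleB -/(chi S c K t) => /eqP; rewrite subr_eq0 => /eqP sE.
rewrite /mu; under eq_bigr do rewrite mulrC -scalerA.
by rewrite -scaler_sumr sE scalerA mulVf ?scale1r ?gt_eqF ?chi_gt0.
Qed.

Lemma mu_tau y : pos_hull (pts S K) y -> mu S c K (tau S c K y) = y.
Proof.
by move=> /mu_surj[t tX ty]; apply: pinvK; apply/mem_set; exists t.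
Qed.

(* [mu] is the gradient of the convex function [ln chi]; convexity enters only
   through the tangent inequality [1 + z <= exp z]. *)
Lemma legendre_max t s :
  dotp (mu S c K t) s - ln (chi S c K s) <=
  dotp (mu S c K t) t - ln (chi S c K t).
Proof.
set y := mu S c K t.
rewrite lerBlDr -lerBlDl.
have -> : dotp y s - (dotp y t - ln (chi S c K t)) =
    ln (chi S c K t * expR (dotp y (s - t))).
  by rewrite lnM ?posrE ?expR_gt0 ?chi_gt0 // expRK dotpBr; ring.
rewrite ler_ln ?posrE ?mulr_gt0 ?expR_gt0 ?chi_gt0 //.
(* Centring at the mean makes the first-order terms cancel. This zero is added below so that the
   tangent inequality applies term by term. *)
have bal : \sum_(a <- pts S K) (c a * expR (dotp a t)) * dotp (a - y) (s - t) = 0.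
  transitivity (dotp (\sum_(a <- pts S K) (c a * expR (dotp a t)) *: (a - y)) (s - t)).
    by rewrite dotp_suml; apply: eq_bigr => a _; rewrite dotpZl.
  have -> : \sum_(a <- pts S K) (c a * expR (dotp a t)) *: (a - y) = 0.
    rewrite sum_scaleB -/(chi S c K t) /y /mu scaler_sumr -sumrB big1 // => a _.
    by rewrite scalerA [chi S c K t * _]mulrC divfK ?subrr ?gt_eqF ?chi_gt0.
  exact: dotp0l.
rewrite -[X in X * _]addr0 -bal -big_split mulr_suml /= /chi.
rewrite big_seq [leRHS]big_seq; apply: ler_sum => a aK.
have -> : expR (dotp a s) =
    expR (dotp a t) * expR (dotp (a - y) (s - t)) * expR (dotp y (s - t)).
  by rewrite -!expRD dotpBl !dotpBr; congr expR; ring.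
rewrite !mulrA ler_pM2r ?expR_gt0 // -[X in X + _]mulr1 -mulrDr.
by rewrite ler_pM2l ?expR_ge1Dx // mulr_gt0 ?c_gt0 ?expR_gt0.
Qed.

End MomentMap.

(** * Behaviour of the Legendre transform along rays *)

Section Legendre.
Context {R : realType} {m : nat}.
Local Notation V := 'rV[R]_m.
Implicit Types (S : {fset V}) (K L : set V) (x y t u a : V) (r h : R).

(** Each term is bounded through [exp (- z) <= 1 / z] for [z > 0]; the added 1 keeps [C] positive
    when [B] is empty. *)
Lemma expsum_decay (B : {fset V}) (c d : V -> R) :
  (forall a, a \in B -> 0 < c a) -> (forall a, a \in B -> 0 < d a) ->
  exists2 C : R, 0 < C &
    forall r, 0 < r -> \sum_(a <- B) c a * expR (- (r * d a)) <= C / r.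
Proof.
move=> c0 d0; exists (1 + \sum_(a <- B) c a / d a).
  rewrite ltr_pwDl // big_seq sumr_ge0 // => a aB.
  by rewrite divr_ge0 // ltW ?c0 ?d0.
move=> r r0; rewrite mulrDl ler_wpDl ?divr_ge0 ?(ltW r0) //.
rewrite mulr_suml big_seq [leRHS]big_seq; apply: ler_sum => a aB.
rewrite -mulrA ler_pM2l ?c0 // expRN -invfM [d a * r]mulrC.
have rd : 0 < r * d a by rewrite mulr_gt0 ?d0.
rewrite lef_pV2 ?posrE ?expR_gt0 //.
by apply: le_trans (expR_ge1Dx _); rewrite lerDr.
Qed.

Lemma legendre_unbounded S (c : V -> R) K y u :
  (forall a, a \in pts S K -> 0 < c a) -> pts S K != fset0 ->
  (forall a, a \in pts S K -> dotp u a < dotp u y) ->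
  forall r, exists t, r <= dotp y t - ln (chi S c K t).
Proof.
move=> c0 K0 uy r.
have [|C C0 HC] := expsum_decay (d := fun a => dotp u y - dotp u a) c0.
  by move=> a aK; rewrite subr_gt0 uy.
(* Along [q *: u] the quotient of [chi] by [exp <y, q u>] is at most [C / q], which this choice
   turns into [exp (- r)]. *)
pose q := C * expR r; have q0 : 0 < q by rewrite mulr_gt0 ?expR_gt0.
exists (q *: u); rewrite lerBrDl -lerBrDr -[leRHS]expRK.
rewrite ler_ln ?posrE ?chi_gt0 ?expR_gt0 //.
rewrite expRD -ler_pdivrMl ?expR_gt0 //.
have := HC _ q0; rewrite /q invfM mulrA divff ?gt_eqF // mul1r -expRN.
apply: le_trans; rewrite -/q mulr_sumr le_eqVlt; apply/orP; left; apply/eqP.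
apply: eq_bigr => a _; rewrite mulrCA -expRN -expRD; congr (_ * expR _).
by rewrite !dotpZr (dotpC y) (dotpC a); ring.
Qed.

(* Moving to infinity along the normal [u] of the face [L] kills the terms of
   [chi K] outside [L]. *)
Lemma legendre_face_approx S (c : V -> R) K L u h y t (e : R) :
  (forall a, a \in pts S K -> 0 < c a) -> pts S L != fset0 ->
  (forall a, a \in pts S K -> dotp u a <= h) ->
  pts S L = [fset a in pts S K | dotp u a == h]%fset ->
  dotp u y = h -> 0 < e -> exists s,
  dotp y t - ln (chi S c L t) - e <= dotp y s - ln (chi S c K s).
Proof.
move=> c0 L0 uh LE uy e0.
have cL a : a \in pts S L -> 0 < c a by rewrite LE in_fset_filter => /andP[/c0].
have chiL := chi_gt0 cL L0 t.
pose Z := [fset a in pts S K | dotp u a != h]%fset.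
have [| |C C0 HC] := @expsum_decay Z (fun a => c a * expR (dotp a t))
    (fun a => h - dotp u a).
- by move=> a; rewrite in_fset_filter => /andP[/c0 ? _]; rewrite mulr_gt0 ?expR_gt0.
- move=> a; rewrite in_fset_filter => /andP[/uh ? ?].
  by rewrite subr_gt0 lt_neqAle; apply/andP.
(* The terms off [L] then total at most [e * chi S c L t], and [1 + e <= exp e] turns this into an
   additive error [e] in the logarithm. *)
pose r := C / (chi S c L t * e).
have r0 : 0 < r by rewrite divr_gt0 // mulr_gt0.
have K0 : pts S K != fset0.
  have /fset0Pn[a] := L0; rewrite LE in_fset_filter => /andP[aK _].
  by apply/fset0Pn; exists a.
exists (t + r *: u).
have chiK : chi S c K (t + r *: u) = expR (r * h) * (chi S c L t +
    \sum_(a <- Z) c a * expR (dotp a t) * expR (- (r * (h - dotp u a)))).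
  rewrite {1}/chi (big_fsetID _ (fun a => dotp u a == h)) /= -LE mulrDr.
  rewrite /chi !mulr_sumr; congr (_ + _); last first.
    apply: eq_bigr => a _; rewrite -mulrA mulrCA -!expRD dotpDr dotpZr (dotpC a u).
    by congr (_ * expR _); ring.
  rewrite big_seq [RHS]big_seq; apply: eq_bigr => a.
  rewrite LE in_fset_filter => /andP[_ /eqP ua].
  by rewrite mulrCA -expRD dotpDr dotpZr (dotpC a u) ua [r * h + _]addrC.
have : chi S c K (t + r *: u) <= expR (r * h + ln (chi S c L t) + e).
  rewrite chiK addrAC [expR (_ + ln _)]expRD lnK ?posrE // expRD -mulrA.
  rewrite ler_pM2l ?expR_gt0 //.
  apply: le_trans (_ : _ <= chi S c L t + C / r) _; first by rewrite lerD2l HC.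
  have -> : C / r = e * chi S c L t by rewrite /r; field; rewrite ?gt_eqF ?C0.
  rewrite -[X in X + _]mul1r -mulrDl ler_pM2r //.
  exact: expR_ge1Dx.
rewrite -ler_ln ?posrE ?expR_gt0 ?chi_gt0 // expRK => le_ln.
rewrite dotpDr dotpZr (dotpC y u) uy; lra.
Qed.

End Legendre.

(** * The rate function and its explicit value *)

Section RateFunction.
Context {R : realType} {m : nat}.
Local Notation V := 'rV[R]_m.
Variables (S : {fset V}) (c : V -> R) (P K : set V) (x : V).
Hypothesis c_gt0 : forall a, a \in pts S K -> 0 < c a.
Hypothesis pts_neq0 : pts S K != fset0.
Hypothesis face_x : face_at P x = K.

(** The Bernstein weights at [x] are the weights [c] tilted by [tau S c K x] and normalised, so a
    further tilt by [t] adds to the exponent. *)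
Lemma chi_at_shift t :
  chi_at S c P x t = chi S c K (tau S c K x + t) / chi S c K (tau S c K x).
Proof.
have sub : (pts S K `<=` S)%fset.
  by apply/fsubsetP => a; rewrite in_pts => /andP[].
rewrite /chi_at -(big_fset_incl _ sub); last first.
  by move=> a _ /negPf aK; rewrite /bernstein_weight face_x aK mul0r.
rewrite {1}/chi mulr_suml big_seq [RHS]big_seq; apply: eq_bigr => a aK.
by rewrite /bernstein_weight face_x aK dotpDr expRD (dotpC t); ring.
Qed.

Lemma rateE y : rate S c P x y = ereal_sup (range (fun s : V =>
  (dotp y s - ln (chi S c K s) +
    (ln (chi S c K (tau S c K x)) - dotp y (tau S c K x)))%:E)).
Proof.
set T := tau S c K x.
have shift t : dotp y t - ln (chi_at S c P x t) =
    dotp y (T + t) - ln (chi S c K (T + t)) + (ln (chi S c K T) - dotp y T).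
  rewrite chi_at_shift ln_div ?posrE ?chi_gt0 // -/T dotpDr; ring.
congr ereal_sup; apply/seteqP; split => _ [t _ <-].
  by exists (T + t) => //; rewrite shift.
by exists (t - T) => //; rewrite shift [T + _]addrC subrK.
Qed.

End RateFunction.

Unset Implicit Arguments.

Theorem proposition3p16 (R : realType) (m : nat)
    (P : set 'rV[R]_m) (S : {fset 'rV[R]_m}) (c : 'rV[R]_m -> R)
    (hP : polytope P) (hPint : interior P !=set0)
    (hSP : forall a, a \in S -> P a) (hS : conv_hull S = P)
    (hc : forall a, a \in S -> 0 < c a)
    (K : set 'rV[R]_m) (hK : relopen_face P K)
    (x : 'rV[R]_m) (hx : K x) (y : 'rV[R]_m) :
  (~ closure K y -> rate S c P x y = +oo%E) /\
  (closure K y ->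
    rate S c P x y =
      (delta S c K x - delta_ext S c K y + dotp (x - y) (tau S c K x))%:E).
Proof.
rewrite -hS in hK *.
have faceK := face_at_unique hK hx.
have [u [h [uh B0 KE cK]]] := relopen_face_conv_hullP hK.
have ptsK := pts_closure_conv_hull uh cK.
have ptsc L a : a \in pts S L -> 0 < c a by rewrite in_pts => /andP[/hc].
have K0 : pts S K != fset0 by rewrite ptsK.
rewrite -ptsK in cK.
rewrite (rateE (ptsc K) K0 faceK); set T := tau S c K x; split.
  rewrite cK => /conv_hull_separation[v vy]; apply/eqyP => r _.
  (* The threshold is lowered by the constant that [rateE] adds. *)
  have [t rt] := legendre_unbounded (ptsc K) K0 vy
    (r - (ln (chi S c K T) - dotp y T)).
  apply: le_ereal_sup_tmp; eexists; first by exists t.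
  by rewrite lee_fin -lerBlDr.
rewrite /delta_ext cK => Ky.
have [hL Ly] := face_atP Ky; set L := face_at _ y in hL Ly *.
have [v [k [vk BL0 LE cL]]] := relopen_face_conv_hullP hL.
have ptsL := pts_face erefl cK vk cL.
have L0 : pts S L != fset0 by rewrite ptsL.
rewrite LE -ptsL in Ly; have muL := mu_tau (ptsc L) L0 Ly.
have vy : dotp v y = k.
  have := pos_hull_conv Ly; rewrite ptsL -conv_hull_faceE //; by case.
set t := tau S c L y in muL.
(* The terms in [dotp x T] cancel, leaving the Legendre value for [L] at [t] plus the affine term of
   [rateE]. *)
have -> : delta S c K x - delta S c L y + dotp (x - y) T =
    dotp y t - ln (chi S c L t) + (ln (chi S c K T) - dotp y T).
  by rewrite /delta -/T -/t dotpBl; ring.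
apply/eqP; rewrite eq_le; apply/andP; split.
  apply/ereal_supP => _ [s _ <-]; rewrite lee_fin lerD2r.
  (* Upper bound: [chi] for [L] omits positive terms of [chi] for [K], and the transform for [L] is
     maximal at [t] because [muL] holds. *)
  have := legendre_max (ptsc L) L0 t s; rewrite muL; apply: le_trans.
  rewrite lerD2l lerN2 ler_ln ?posrE ?chi_gt0 //; try exact: ptsc.
  rewrite /chi ptsL -big_fset_condE [leRHS](bigID (fun a => dotp v a == k)) /=.
  rewrite lerDl big_seq_cond sumr_ge0 // => a /andP[/ptsc ca _].
  by rewrite mulr_ge0 ?expR_ge0 // ltW.
(* Lower bound: the supremum need not be attained when [L] is a proper face, so it is approached
   within every [e]. *)
apply/lee_addgt0Pr => e e0.
have [s se] := legendre_face_approx t (ptsc K) L0 vk ptsL vy e0.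
rewrite -leeBlDr // ; apply: le_ereal_sup_tmp; eexists; first by exists s.
by rewrite -EFinB lee_fin addrAC lerD2r.
Qed.
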